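(* Let the search setting be as described in the context (target set $\mathcal T$ of cardinality $l$, information sets $A_1,\dots,A_n$ with $\mathcal T\subseteq A_1\cup\dots\cup A_n$, reliability coefficients $\alpha_j$, initial state $|s\rangle$ with amplitudes $\beta_i$, Hamiltonian $H$ with $E\neq 0$). Assume basic confidence, i.e. $A_j\cap\mathcal T\neq\emptyset$ for every $j=1,\dots,n$. Then $$y=\Big(\sum_{i=1}^{l}\beta_i^2\Big)^{1/2}\ge\frac{1}{n^{1/2}(l+R)^{1/2}},$$ where $l+R$ is the total number of distinct elements of $A_1\cup\dots\cup A_n$. Consequently, the time $T$ required for $|\psi(T)\rangle$ to reach $\mathcal L$ is $$T=\frac{\pi}{2Ey}\le\frac{\pi n^{1/2}}{2E}(l+R)^{1/2}.$$
   Context: $\bar A$ is a finite set of $N$ objects, and $\mathcal H$ is an $N$-dimensional Hilbert space with orthonormal basis $\{|w\rangle: w\in\bar A\}$. The target set is $\mathcal T=\{w_1,\dots,w_l\}\subset\bar A$ ($l$ distinct elements) and $\mathcal L=\mathrm{span}\{|w_1\rangle,\dots,|w_l\rangle\}$. There are $n$ (possibly overlapping) information sets $A_1,\dots,A_n\subset\bar A$ with $\mathcal T\subseteq A_1\cup\dots\cup A_n$, and reliability coefficients $\alpha_1,\dots,\alpha_n>0$ with $\sum_{j=1}^n\alpha_j=1$. Let $w_{l+1},\dots,w_{l+R}$ be the distinct elements of $(A_1\cup\dots\cup A_n)\setminus\mathcal T$. The initial state is the unit vector $$|s\rangle=\frac1\nu\sum_{j=1}^n\alpha_j\sum_{w\in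 A_j}|w\rangle=\sum_{i=1}^{l+R}\beta_i|w_i\rangle,\qquad \beta_i=\frac1\nu\sum_{j:\,w_i\in A_j}\alpha_j,$$ where $\nu>0$ is the normalization constant making $\||s\rangle\|=1$. The search evolves by $i\frac{d}{dt}|\psi(t)\rangle=H|\psi(t)\rangle$ for $t>0$, $|\psi(0)\rangle=|s\rangle$, with $H=E\sum_{j=1}^{l}|w_j\rangle\langle w_j|+E|s\rangle\langle s|$, $E\neq0$. The time required to reach $\mathcal L$ means the time $T=\frac{\pi}{2Ey}$, at which $|\psi(T)\rangle\in\mathcal L$.
   Formalization: For E<0 the time π/(2Ey) is negative and the stated bound on T reverses and fails; the formal theorem proves the time claim as written for E>0, and for E<0 proves it with |T| in place of T and |E| in place of E in the bound. *)

(* Defs.v *)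
From HB Require Import structures.
From mathcomp Require Import all_boot all_order all_algebra.
From mathcomp Require Import complex.
From mathcomp Require Import all_classical all_reals all_analysis.

Set Implicit Arguments.
Unset Strict Implicit.
Unset Printing Implicit Defensive.

Import Order.TTheory GRing.Theory Num.Theory.
Import numFieldNormedType.Exports.

Local Open Scope classical_set_scope.
Local Open Scope complex_scope.
Local Open Scope sesquilinear_scope.
Local Open Scope ring_scope.

(* The Hilbert space spanned by the orthonormal kets |w>, w : O. *)
Notation hilbert R O := 'cV[R[i]]_#|O|.

Definition ket (R : realType) (O : finType) (w : O) : hilbert R O :=
  delta_mx (enum_rank w) 0.

(* Antilinear in the first argument. *)
Definition braket (R : realType) (O : finType) (u v : hilbert R O) : R[i] :=
  (u ^t* *m v) 0 0.

Definition hnorm (R : realType) (O : finType) (v : hilbert R O) : R[i] :=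
  sqrtC (braket v v).

Definition projector (R : realType) (O : finType) (v : hilbert R O) :
    'M[R[i]]_#|O| :=
  v *m v ^t*.

Definition target_space (R : realType) (O : finType) (T : {set O}) :
    {vspace hilbert R O} :=
  <<[seq ket R w | w in T]>>%VS.

Definition initial_state (R : realType) (O : finType) (n : nat)
    (A : 'I_n -> {set O}) (alpha : 'I_n -> R) (nu : R) : hilbert R O :=
  (nu^-1)%:C *: \sum_(j < n) (alpha j)%:C *: \sum_(w in A j) ket R w.

(* The amplitude of w in the initial state. *)
Definition beta (R : realType) (O : finType) (n : nat)
    (A : 'I_n -> {set O}) (alpha : 'I_n -> R) (nu : R) (w : O) : R :=
  nu^-1 * \sum_(j < n | w \in A j) alpha j.

Definition hamiltonian (R : realType) (O : finType) (T : {set O}) (E : R)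
    (s : hilbert R O) : 'M[R[i]]_#|O| :=
  E%:C *: \sum_(w in T) projector (ket R w) + E%:C *: projector s.

(* Derivatives and limits of curves are taken on the real and imaginary parts
   of each coordinate. *)
Definition curve_derive (R : realType) (O : finType) (psi : R -> hilbert R O)
    (t : R) (d : hilbert R O) : Prop :=
  forall k : 'I_#|O|,
    is_derive t 1 (fun x : R => complex.Re (psi x k 0)) (complex.Re (d k 0)) /\
    is_derive t 1 (fun x : R => complex.Im (psi x k 0)) (complex.Im (d k 0)).

Definition curve_cvg0 (R : realType) (O : finType) (psi : R -> hilbert R O)
    (v : hilbert R O) : Prop :=
  forall k : 'I_#|O|,
    (fun x : R => complex.Re (psi x k 0)) @ 0^'+ --> complex.Re (v k 0) /\
    (fun x : R => complex.Im (psi x k 0)) @ 0^'+ --> complex.Im (v k 0).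

(* Since the equation is only imposed for t > 0, the initial condition includes
   right-continuity at 0; otherwise it would not constrain the evolution. *)
Definition schrodinger (R : realType) (O : finType) (H : 'M[R[i]]_#|O|)
    (s : hilbert R O) (psi : R -> hilbert R O) : Prop :=
  [/\ psi 0 = s,
      curve_cvg0 psi s
    & forall t : R, 0 < t ->
        exists2 d : hilbert R O, curve_derive psi t d &
          'i%C *: d = H *m psi t].

(* Main.v *)
Require Import Defs.
From mathcomp Require Import all_boot all_order all_algebra.
From mathcomp Require Import complex.
From mathcomp Require Import all_classical all_reals all_analysis.
From mathcomp Require Import ring lra.

Set Implicit Arguments.
Unset Strict Implicit.
Unset Printing Implicit Defensive.

Import Order.TTheory GRing.Theory Num.Theory.
Import numFieldNormedType.Exports.
Local Open Scope classical_set_scope.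
Local Open Scope sesquilinear_scope.
Local Open Scope complex_scope.
Local Open Scope ring_scope.

(** Inequality: each coefficient [nu * beta w] is at most 1, so normalization
gives [nu ^ 2 <= l + R]; each [A j] meets [T], so expanding the squares gives
[nu ^ 2 * y ^ 2 >= \sum_j alpha_j ^ 2 >= 1 / n].

Dynamics: let [P] be the projector on the span of the targets and
[p = <s| P].  Then [p + y <s|] and [p - y <s|] are left eigenvectors of [H],
with eigenvalues [E (1 + y)] and [E (1 - y)], and for [w] outside [T] the row
[(1 - y ^ 2) <w| - beta_w (<s| - p)] is annihilated by [H].  A left eigenvector
applied to [psi t] evolves by a phase.  When [cos (E y t) = 0] the two phases
are opposite, hence [<s|psi t> = p (psi t)], and the third row then gives
[(1 - y ^ 2) <w|psi t> = 0].  If [y = 1], [beta_w = 0] and [<w|] itself is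
stationary. *)

(** * Evolution of scalars and of left eigenvectors *)

(** The mean value theorem makes [f] constant on the positive half-line, so its value there is its
    right limit at 0. *)
Lemma eq_rlim_of_is_derive0 (R : realType) (f : R -> R) (c t : R) :
  (forall x : R, 0 < x -> is_derive x 1 f 0) -> f @ 0^'+ --> c -> 0 < t -> f t = c.
Proof.
move=> f'0 fc t_gt0.
have fcst x : 0 < x -> f x = f t.
  move=> x_gt0.
  have ltcase a b : 0 < a -> a < b -> f a = f b.
    move=> a_gt0 ab.
    have itv_gt0 (x0 : R) : x0 \in `[a, b] -> 0 < x0.
      by rewrite in_itv /= => /andP[ax0 _]; exact: lt_le_trans ax0.
    have [x0 /subset_itv_oo_cc x0ab||c0 _] := @MVT R f (fun=> 0) a b ab.
    - by apply: f'0; exact: itv_gt0.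
    - apply: derivable_within_continuous => x0 /itv_gt0/f'0 df.
      exact: ex_derive.
    - by rewrite mul0r => /eqP; rewrite subr_eq0 => /eqP.
  by case: (ltgtP x t) => [/ltcase->//|/ltcase->//|->].
(* [f t] is also a right limit of [f] at 0, because [f] takes this value at every positive point. *)
apply: (cvg_unique _ _ fc) => //.
apply: cvg_near_cst; near=> x.
by apply: fcst; near: x; exact: nbhs_right_gt.
Unshelve. all: by end_near. Qed.

(** Integrating factor: a solution of [i f' = lam f] multiplied by [exp (i lam t)] has zero
    derivative. The argument runs on real and imaginary parts, where derivatives are defined. *)
Lemma phase_evolution (R : realType) (f : R -> R[i]) (lam : R) (c : R[i]) :
  (fun x : R => complex.Re (f x)) @ 0^'+ --> complex.Re c ->
  (fun x : R => complex.Im (f x)) @ 0^'+ --> complex.Im c ->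
  (forall t : R, 0 < t -> exists2 d : R[i],
     is_derive t 1 (fun x : R => complex.Re (f x)) (complex.Re d) /\
     is_derive t 1 (fun x : R => complex.Im (f x)) (complex.Im d) &
     'i%C * d = lam%:C * f t) ->
  forall t : R, 0 < t -> f t * (cos (lam * t) +i* sin (lam * t))%C = c.
Proof.
move=> fRe fIm df t t_gt0.
have dlin (x : R) : is_derive x 1 (fun z : R => lam * z) lam.
  rewrite -[X in is_derive _ _ _ X]mulr1.
  exact: (@is_deriveZ R R R id lam x 1 1).
have dc (x : R) : is_derive x 1 (fun z : R => cos (lam * z)) (- sin (lam * x) * lam).
  exact: (@is_derive1_comp R cos (fun z : R => lam * z)).
have ds (x : R) : is_derive x 1 (fun z : R => sin (lam * z)) (cos (lam * x) * lam).
  exact: (@is_derive1_comp R sin (fun z : R => lam * z)).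
have cc : (fun z : R => cos (lam * z)) @ 0^'+ --> (1 : R).
  rewrite -[1]cos0 -[in cos 0](mulr0 lam); apply: cvg_at_right_filter.
  by apply: differentiable_continuous; apply/derivable1_diffP; exact: ex_derive.
have cs : (fun z : R => sin (lam * z)) @ 0^'+ --> (0 : R).
  rewrite -[X in _ --> X]sin0 -[in sin 0](mulr0 lam); apply: cvg_at_right_filter.
  by apply: differentiable_continuous; apply/derivable1_diffP; exact: ex_derive.
(* The two parts of [i f' = lam f] read [(Re f)' = lam Im f] and [(Im f)' = - lam Re f]. *)
have df' (x : R) : 0 < x ->
    is_derive x 1 (fun x : R => complex.Re (f x)) (lam * complex.Im (f x)) /\
    is_derive x 1 (fun x : R => complex.Im (f x)) (- (lam * complex.Re (f x))).
  move=> /df[d [dR dI]]; case: d (f x) dR dI => [a b] [a' b'] /= dR dI [].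
  by rewrite !mul0r !mul1r !add0r subr0 addr0 => <- <-; rewrite opprK.
have -> : c = (complex.Re c +i* complex.Im c)%C by case: c {fRe fIm}.
have -> : f t * (cos (lam * t) +i* sin (lam * t))%C =
  ((complex.Re (f t) * cos (lam * t) - complex.Im (f t) * sin (lam * t)) +i*
   (complex.Re (f t) * sin (lam * t) + complex.Im (f t) * cos (lam * t)))%C.
  by case: (f t).
congr (_ +i* _)%C.
- apply: (@eq_rlim_of_is_derive0 R (fun x => complex.Re (f x) * cos (lam * x)
      - complex.Im (f x) * sin (lam * x)) (complex.Re c) t) => //.
    move=> x x0; have [dR dI] := df' _ x0.
    have D := is_deriveB (is_deriveM dR (dc x)) (is_deriveM dI (ds x)).
    apply: (is_derive_eq D).
    by rewrite /GRing.scale /=; ring.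
  rewrite -[complex.Re c]subr0 -[X in _ - X](mulr0 (complex.Im c)).
  rewrite -[X in X - _]mulr1.
  by apply: cvgB; apply: cvgM.
- apply: (@eq_rlim_of_is_derive0 R (fun x => complex.Re (f x) * sin (lam * x)
      + complex.Im (f x) * cos (lam * x)) (complex.Im c) t) => //.
    move=> x x0; have [dR dI] := df' _ x0.
    have D := is_deriveD (is_deriveM dR (ds x)) (is_deriveM dI (dc x)).
    apply: (is_derive_eq D).
    by rewrite /GRing.scale /=; ring.
  rewrite -[complex.Im c]add0r -[X in X + _](mulr0 (complex.Re c)).
  rewrite -[X in _ + X]mulr1.
  by apply: cvgD; apply: cvgM.
Qed.

(** Multiplying the equation by [a] on the left turns [a *m H] into [lam a], so the scalar
    [a *m psi t] solves [i f' = lam f]. The rest carries limits and derivatives of real and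
    imaginary parts through a finite sum. *)
Lemma left_eigenvector_evolution (R : realType) (O : finType)
    (H : 'M[R[i]]_#|O|) (s : hilbert R O) (psi : R -> hilbert R O)
    (a : 'rV[R[i]]_#|O|) (lam : R) :
  schrodinger H s psi -> a *m H = lam%:C *: a ->
  forall t : R, 0 < t ->
    (a *m psi t) 0 0 * (cos (lam * t) +i* sin (lam * t))%C = (a *m s) 0 0.
Proof.
move=> [_ psi0 psiE] aH.
have ReE (v : hilbert R O) : complex.Re ((a *m v) 0 0) =
    \sum_k (complex.Re (a 0 k) * complex.Re (v k 0)
           - complex.Im (a 0 k) * complex.Im (v k 0)).
  rewrite mxE (raddf_sum (@complex.Re R : Rcomplex R -> R)).
  by apply: eq_bigr => k _; case: (a 0 k) (v k 0) => [? ?] [? ?].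
have ImE (v : hilbert R O) : complex.Im ((a *m v) 0 0) =
    \sum_k (complex.Re (a 0 k) * complex.Im (v k 0)
           + complex.Im (a 0 k) * complex.Re (v k 0)).
  rewrite mxE (raddf_sum (@complex.Im R : Rcomplex R -> R)).
  by apply: eq_bigr => k _; case: (a 0 k) (v k 0) => [? ?] [? ?].
have derive_comb (p q : 'I_#|O| -> R) (u v : 'I_#|O| -> R -> R)
    (du dv : 'I_#|O| -> R) (t : R) :
    (forall k, is_derive t 1 (u k) (du k)) ->
    (forall k, is_derive t 1 (v k) (dv k)) ->
    is_derive t 1 (fun x : R => \sum_k (p k * u k x + q k * v k x))
      (\sum_k (p k * du k + q k * dv k)).
  move=> hu hv.
  have D k := is_deriveD (is_deriveZ (p k) (hu k)) (is_deriveZ (q k) (hv k)).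
  have := is_derive_sum D.
  by congr is_derive; apply/funext => x; rewrite fct_sumE.
apply: phase_evolution.
- rewrite ReE; under eq_fun do rewrite ReE.
  apply: cvg_big => [|k _]; first exact: add_continuous.
  have [r i] := psi0 k.
  by apply: cvgB; apply: cvgM => //; exact: cvg_cst.
- rewrite ImE; under eq_fun do rewrite ImE.
  apply: cvg_big => [|k _]; first exact: add_continuous.
  have [r i] := psi0 k.
  by apply: cvgD; apply: cvgM => //; exact: cvg_cst.
- move=> t /psiE[d dpsi eqd]; exists ((a *m d) 0 0); last first.
    have := congr1 (fun v => (a *m v) 0 0) eqd.
    by rewrite mulmxA aH -scalemxAr -scalemxAl mxE [in RHS]mxE.
  split.
    rewrite ReE; under eq_fun do rewrite ReE.
    (* The sign moves into the coefficient, so that [derive_comb] covers the real part too. *)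
    under eq_fun do under eq_bigr do rewrite -mulNr.
    under [X in is_derive _ _ _ X]eq_bigr do rewrite -mulNr.
    by apply: derive_comb => k; have [] := dpsi k.
  rewrite ImE; under eq_fun do rewrite ImE.
  by apply: derive_comb => k; have [] := dpsi k.
Qed.

(** * Coordinates of the initial state and of the target projector *)

Lemma initial_state_amplitude (R : realType) (O : finType) (n : nat)
    (A : 'I_n -> {set O}) (alpha : 'I_n -> R) (nu : R) (k : 'I_#|O|) :
  initial_state A alpha nu k 0 = (beta A alpha nu (enum_val k))%:C.
Proof.
rewrite /initial_state mxE summxE /beta rmorphM rmorph_sum /=; congr (_ * _).
rewrite [RHS]big_mkcond; apply: eq_bigr => j _; rewrite mxE summxE.
under eq_bigr do rewrite mxE eqxx andbT.
case: ifPn => [kA|kA].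
  rewrite (bigD1 (enum_val k)) //= enum_valK eqxx big1 ?addr0 ?mulr1 // => w.
  by move=> /andP[_ wk]; case: eqP => // kw; rewrite kw enum_rankK eqxx in wk.
rewrite big1 ?mulr0 // => w wA.
by case: eqP => // kw; rewrite kw enum_rankK wA in kA.
Qed.

(** Lets the target projector act on a row as a 0/1 mask of its coordinates. *)
Lemma sum_projector_ketE (R : realType) (O : finType) (T : {set O}) :
  \sum_(w in T) projector (ket R w) =
  diag_mx (\row_k (enum_val k \in T)%:R) :> 'M[R[i]]_#|O|.
Proof.
apply/matrixP => i j; rewrite summxE !mxE.
under eq_bigr => w _ do rewrite mxE big_ord1 !mxE !eqxx !andbT conjC_nat -natrM mulnb.
have rankE (w : O) : (i == enum_rank w) = (w == enum_val i).
  by rewrite eq_sym -(inj_eq enum_val_inj) enum_rankK.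
under eq_bigr do rewrite rankE.
case: (boolP (enum_val i \in T)) => iT.
  rewrite (bigD1 (enum_val i)) //= eqxx enum_valK big1 => [|w /andP[_ /negPf->]//].
  by rewrite addr0 eq_sym mulr1n; case: eqP.
rewrite big1 ?mul0rn // => w wT.
by case: eqP => // wi; rewrite -wi wT in iT.
Qed.

Lemma adjoint_amplitude (R : realType) (O : finType) (be : O -> R)
    (s : hilbert R O) :
  (forall k, s k 0 = (be (enum_val k))%:C) ->
  forall k, s ^t* 0 k = (be (enum_val k))%:C.
Proof. by move=> sE k; rewrite !mxE sE conj_Creal // complex_real. Qed.

Lemma sum_enum_val (R : realType) (O : finType) (F : O -> R) :
  \sum_(k < #|O|) (F (enum_val k))%:C = (\sum_w F w)%:C.
Proof. by rewrite rmorph_sum /= (big_enum_val (fun w => (F w)%:C)). Qed.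

(** * Vanishing of the amplitudes outside the target set *)

(** The time enters only through [cos (E * y * t) = 0], so that both signs of [E] are served at
    once. *)
Lemma off_target_amplitude (R : realType) (O : finType) (T : {set O})
    (be : O -> R) (s : hilbert R O) (E y : R) (psi : R -> hilbert R O)
    (t : R) (w : O) :
  (forall k, s k 0 = (be (enum_val k))%:C) ->
  \sum_v be v ^+ 2 = 1 -> \sum_(v in T) be v ^+ 2 = y ^+ 2 -> 0 < y ->
  schrodinger (hamiltonian T E s) s psi ->
  0 < t -> cos (E * y * t) = 0 -> w \notin T ->
  psi t (enum_rank w) 0 = 0.
Proof.
move=> sE be1 bey y_gt0 psiE t_gt0 cosEyt wT.
set P : 'M[R[i]]_#|O| := \sum_(v in T) projector (ket R v).
(* Here [b] is [<s|], [p] is [<s| P] and [e] is [<w|]. *)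
pose b := s ^t*; pose p := b *m P; set e : 'rV[R[i]]_#|O| := delta_mx 0 (enum_rank w).
have bE := adjoint_amplitude sE.
have mulP (a : 'rV[R[i]]_#|O|) k : (a *m P) 0 k = a 0 k * (enum_val k \in T)%:R.
  by rewrite /P sum_projector_ketE mul_mx_diag !mxE.
have pP : p *m P = p.
  by apply/rowP => k; rewrite !mulP -mulrA -natrM mulnb andbb.
have eP : e *m P = 0.
  apply/rowP => k; rewrite mulP !mxE eqxx /=.
  by case: eqP => [->|]; rewrite ?mul0r // enum_rankK (negPf wT) mulr0.
have bs : b *m s = 1%:M.
  apply/matrixP => i j; rewrite !ord1 !mxE eqxx mulr1n.
  under eq_bigr do rewrite bE sE -rmorphM -expr2.
  by rewrite (sum_enum_val (fun v => be v ^+ 2)) be1.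
have ps : p *m s = (y ^+ 2)%:C%:M.
  apply/matrixP => i j; rewrite !ord1 !mxE eqxx mulr1n -bey.
  under eq_bigr do rewrite mulP bE sE mulrAC -rmorphM -expr2 mulr_natr mulrb.
  rewrite [in RHS]big_mkcond -sum_enum_val.
  by apply: eq_bigr => k _; case: ifP.
have es : e *m s = (be w)%:C%:M.
  apply/matrixP => i j; rewrite !ord1 -rowE !mxE sE enum_rankK eqxx.
  by rewrite mulr1n.
(* The action of [H] on a row [a] depends only on the masked row [a *m P] and the scalar
   [a *m s]. *)
have mulH (a : 'rV[R[i]]_#|O|) (c : R) : a *m s = c%:C%:M ->
    a *m hamiltonian T E s = E%:C *: (a *m P + c%:C *: b).
  move=> ac; rewrite /hamiltonian -/P mulmxDr -!scalemxAr -scalerDr.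
  by rewrite /projector mulmxA ac mul_scalar_mx.
have scal_col (c d : R[i]) : c%:M + d *: 1%:M = (c + d)%:M :> 'M[R[i]]_1.
  by rewrite scale_scalar_mx mulr1 raddfD.
(* With [a = p + y b], [a P = (1 + y) p] and [a s = y (1 + y)], so [a H = E (1 + y) a]. Replacing
   [y] by [- y] gives [evm]. *)
have evp : ((p + y%:C *: b) *m psi t) 0 0 *
    (cos (E * (1 + y) * t) +i* sin (E * (1 + y) * t))%C = (y ^+ 2 + y)%:C.
  rewrite (left_eigenvector_evolution psiE _ t_gt0).
    by rewrite mulmxDl -scalemxAl ps bs scal_col -rmorphD mxE eqxx mulr1n.
  rewrite (mulH _ (y ^+ 2 + y)); last first.
    by rewrite mulmxDl -scalemxAl ps bs scal_col -rmorphD.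
  rewrite mulmxDl -scalemxAl -/p pP rmorphM -scalerA; congr (_ *: _).
  apply/rowP => k; rewrite !mxE !(rmorphD, rmorphXn, rmorph1) /=; ring.
have evm : ((p - y%:C *: b) *m psi t) 0 0 *
    (cos (E * (1 - y) * t) +i* sin (E * (1 - y) * t))%C = (y ^+ 2 - y)%:C.
  rewrite (left_eigenvector_evolution psiE _ t_gt0).
    rewrite mulmxBl -scalemxAl ps bs -scaleNr scal_col -rmorphB.
    by rewrite mxE eqxx mulr1n.
  rewrite (mulH _ (y ^+ 2 - y)); last first.
    by rewrite mulmxBl -scalemxAl ps bs -scaleNr scal_col -rmorphB.
  rewrite mulmxBl -scalemxAl -/p pP rmorphM -scalerA; congr (_ *: _).
  apply/rowP => k; rewrite !mxE !(rmorphB, rmorphXn, rmorph1) /=; ring.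
have stationary (a : 'rV[R[i]]_#|O|) : a *m hamiltonian T E s = 0 ->
    (a *m psi t) 0 0 = (a *m s) 0 0.
  move=> aH; have := left_eigenvector_evolution (lam := 0) psiE _ t_gt0.
  by move=> /(_ a); rewrite aH scale0r mul0r cos0 sin0 mulr1; exact.
(* For this row both [a s = (1 - y^2) beta_w - beta_w (1 - y^2)] and [a P] vanish, so [H]
   annihilates it and its conserved value is 0. *)
have evw : (((1 - y ^+ 2)%:C *: e - (be w)%:C *: (b - p)) *m psi t) 0 0 = 0.
  have s0 : ((1 - y ^+ 2)%:C *: e - (be w)%:C *: (b - p)) *m s = 0%:C%:M.
    rewrite mulmxBl -!scalemxAl mulmxBl es bs ps.
    by apply/matrixP => i j; rewrite !ord1 !mxE eqxx !mulr1n rmorphB rmorph1 rmorph0; ring.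
  rewrite stationary ?s0 ?mxE ?mul0rn //.
  rewrite (mulH _ _ s0) rmorph0 scale0r addr0 mulmxBl -!scalemxAl mulmxBl.
  by rewrite eP -/p pP (subrr p) !scaler0 oppr0 addr0 scaler0.
(* The angles are [E t - E y t] and [E t + E y t]; in the addition formulas only the terms with
   [sin (E y t)] survive, and these have opposite signs. *)
have phaseN : (cos (E * (1 - y) * t) +i* sin (E * (1 - y) * t))%C =
    - (cos (E * (1 + y) * t) +i* sin (E * (1 + y) * t))%C.
  have -> : E * (1 - y) * t = E * t - E * y * t by ring.
  have -> : E * (1 + y) * t = E * t + E * y * t by ring.
  rewrite cosB sinB cosD sinD cosEyt.
  by apply/eqP; rewrite eq_complex /=; apply/andP; split; apply/eqP; ring.
have phase_neq0 : (cos (E * (1 + y) * t) +i* sin (E * (1 + y) * t))%C != 0.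
  rewrite eq_complex /=; apply/negP => /andP[/eqP c0 /eqP d0].
  have := cos2Dsin2 (E * (1 + y) * t); rewrite c0 d0 expr0n addr0 => /eqP.
  by rewrite eq_sym oner_eq0.
have yC_neq0 : y%:C != 0 by rewrite fmorph_eq0 gt_eqF.
pose Z := (b *m psi t) 0 0; pose X := (p *m psi t) 0 0.
have ZX : Z = X.
  apply/eqP; rewrite -subr_eq0; apply/eqP.
  apply: (mulfI (mulf_neq0 phase_neq0 (mulf_neq0 (_ : 2 != 0) yC_neq0))).
    by rewrite pnatr_eq0.
  rewrite mulr0; move: evp evm; rewrite phaseN.
  have -> : ((p + y%:C *: b) *m psi t) 0 0 = X + y%:C * Z.
    by rewrite mulmxDl -scalemxAl mxE; congr (_ + _); exact: mxE.
  have -> : ((p - y%:C *: b) *m psi t) 0 0 = X - y%:C * Z.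
    by rewrite mulmxBl -scalemxAl mxE; congr (_ + _); rewrite mxE; congr (- _); exact: mxE.
  set ph := Complex _ _ => evp evm.
  (* The weights [1 - y] and [1 + y] cancel the initial values [y^2 + y] and [y^2 - y], while the
     left sides combine into [2 y ph (Z - X)]. *)
  transitivity ((1 - y%:C) * ((X + y%:C * Z) * ph) + (1 + y%:C) * ((X - y%:C * Z) * - ph)).
    by ring.
  by rewrite evp evm rmorphB rmorphD rmorphXn /=; ring.
have psiw : (1 - y ^+ 2)%:C * psi t (enum_rank w) 0 = 0.
  rewrite -evw mulmxBl -!scalemxAl mulmxBl -rowE.
  have -> : b *m psi t - p *m psi t = 0.
    apply/matrixP => i j; rewrite !ord1 [RHS]mxE mxE [X in _ + X]mxE.
    by rewrite -/Z -/X ZX subrr.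
  by rewrite scaler0 subr0 !mxE.
have [y1|y1] := eqVneq (y ^+ 2) 1; last first.
  move/eqP: psiw; rewrite mulf_eq0 fmorph_eq0 subr_eq0 eq_sym (negPf y1) /=.
  by move/eqP.
(* If [y^2 = 1], the targets carry the whole norm, so the squares outside [T] sum to 0 and each of
   them vanishes. *)
have bew : be w = 0.
  have h : \sum_(v | v \notin T) be v ^+ 2 = 0.
    by move: be1; rewrite (bigID (mem T)) /= bey y1 => /eqP; rewrite -subr_eq0 addrAC subrr add0r => /eqP.
  move/eqP: (psumr_eq0P (fun v _ => sqr_ge0 (be v)) h wT).
  by rewrite sqrf_eq0 => /eqP.
transitivity ((e *m psi t) 0 0); first by rewrite -rowE mxE.
rewrite stationary ?es ?bew ?mxE ?mul0rn //.
by rewrite (mulH e 0) ?es ?bew // eP rmorph0 scale0r addr0 scaler0.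
Qed.

Lemma mem_target_space (R : realType) (O : finType) (T : {set O})
    (v : hilbert R O) :
  (forall w, w \notin T -> v (enum_rank w) 0 = 0) -> v \in target_space R T.
Proof.
move=> v0.
have -> : v = \sum_k v k 0 *: ket R (enum_val k).
  apply/colP => i; rewrite summxE (bigD1 i) //= big1 => [|k ki].
    by rewrite !mxE enum_valK !eqxx mulr1 addr0.
  by rewrite !mxE enum_valK eq_sym (negPf ki) mulr0.
apply: memv_suml => k _.
have [kT|kT] := boolP (enum_val k \in T).
  by apply: memvZ; apply: memv_span; apply/fintype.imageP; exists (enum_val k).
by rewrite -[k in v k]enum_valK v0 // scale0r mem0v.
Qed.

(** * Bounds on the amplitudes *)

(** Expanding the nonnegative sum of [(alpha j - 1/n)^2] gives [\sum_j alpha j ^+ 2 - 2/n + 1/n]. *)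
Lemma sum_sqr_ge_inv_card (R : realType) (n : nat) (alpha : 'I_n -> R) :
  \sum_(j < n) alpha j = 1 ->
  n%:R^-1 <= \sum_(j < n) alpha j ^+ 2.
Proof.
move=> alpha_sum; have [n0|n0] := posnP n.
  (* For [n = 0] the left side is 0, the inverse of 0 being 0. *)
  by rewrite [leLHS](_ : _ = 0) ?n0 ?invr0 //; apply: sumr_ge0 => j _; exact: sqr_ge0.
have : 0 <= \sum_j (alpha j - n%:R^-1) ^+ 2 by apply: sumr_ge0 => j _; exact: sqr_ge0.
under eq_bigr do rewrite sqrrB -mulrnAr.
rewrite big_split /= sumrB -mulr_suml alpha_sum sumr_const card_ord.
have -> : n%:R^-1 ^+ 2 *+ n = n%:R^-1 :> R.
  by rewrite -mulr_natr expr2 mulfVK // pnatr_eq0 -lt0n.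
lra.
Qed.

Lemma beta_le_invr (R : realType) (O : finType) (n : nat)
    (A : 'I_n -> {set O}) (alpha : 'I_n -> R) (nu : R) (w : O) :
  (forall j, 0 < alpha j) -> \sum_(j < n) alpha j = 1 -> 0 < nu ->
  beta A alpha nu w <= nu^-1.
Proof.
move=> alpha_gt0 alpha_sum nu_gt0; rewrite /beta ler_piMr ?invr_ge0 ?(ltW nu_gt0) // -alpha_sum.
by rewrite [leRHS](bigID (fun j => w \in A j)) /= lerDl; apply: sumr_ge0 => j _; exact: ltW.
Qed.

Lemma beta_ge0 (R : realType) (O : finType) (n : nat)
    (A : 'I_n -> {set O}) (alpha : 'I_n -> R) (nu : R) (w : O) :
  (forall j, 0 < alpha j) -> 0 < nu -> 0 <= beta A alpha nu w.
Proof.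
move=> alpha_gt0 nu_gt0.
by rewrite mulr_ge0 ?invr_ge0 ?(ltW nu_gt0) // sumr_ge0 // => j _; exact: ltW.
Qed.

(** Amplitudes vanish outside the union and are at most [nu^-1] inside it. For a unit state this
    bounds [nu ^+ 2] by the size of the union. *)
Lemma sum_beta_sqr_le (R : realType) (O : finType) (n : nat)
    (A : 'I_n -> {set O}) (alpha : 'I_n -> R) (nu : R) :
  (forall j, 0 < alpha j) -> \sum_(j < n) alpha j = 1 -> 0 < nu ->
  \sum_w beta A alpha nu w ^+ 2 <= nu^-1 ^+ 2 * #|(\bigcup_(j < n) A j)%SET|%:R.
Proof.
move=> alpha_gt0 alpha_sum nu_gt0; rewrite (bigID (mem (\bigcup_(j < n) A j)%SET)) /= [X in _ + X]big1 => [|w wA].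
  rewrite addr0 mulr_natr -sumr_const; apply: ler_sum => w _.
  by rewrite lerXn2r ?nnegrE ?beta_ge0 ?beta_le_invr ?invr_ge0 ?(ltW nu_gt0).
rewrite /beta big_pred0 ?mulr0 ?expr0n // => j; apply/negP => wj.
by move/negP: wA; apply; apply/finset.bigcupP; exists j.
Qed.

Lemma sum_beta_sqr_ge (R : realType) (O : finType) (n : nat)
    (A : 'I_n -> {set O}) (alpha : 'I_n -> R) (nu : R)
    (T : {set O}) :
  (forall j, 0 < alpha j) -> \sum_(j < n) alpha j = 1 -> 
  (forall j : 'I_n, (A j :&: T)%SET != finset.set0) ->
  nu^-1 ^+ 2 / n%:R <= \sum_(w in T) beta A alpha nu w ^+ 2.
Proof.
move=> alpha_gt0 alpha_sum AT; under eq_bigr do rewrite exprMn.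
rewrite -mulr_sumr ler_wpM2l ?sqr_ge0 //.
apply: le_trans (sum_sqr_ge_inv_card alpha_sum) _.
(* Only one factor of each square is expanded over [j]; after the exchange of sums, each [j] must
   contribute at least [alpha j ^+ 2]. *)
under [leRHS]eq_bigr do rewrite expr2 mulr_suml big_mkcond.
rewrite exchange_big /=; apply: ler_sum => j _.
have /finset.set0Pn[w] := AT j; rewrite inE => /andP[wj wT].
(* A common element [w] of [A j] and [T] supplies the diagonal term [alpha j * alpha j]; all other
   terms are nonnegative. *)
rewrite (bigD1 w) //= wj (bigD1 j) //= expr2 mulrDr -addrA lerDl.
rewrite addr_ge0 ?mulr_ge0 ?(ltW (alpha_gt0 _)) ?sumr_ge0 // => [|v _].
  by move=> k _; exact: ltW.
case: ifP => // _; rewrite mulr_ge0 ?(ltW (alpha_gt0 _)) // sumr_ge0 // => k _.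
exact: ltW.
Qed.

(** * Lower bound on [y] and time to reach the target space *)

(** For [E < 0] the formula for the time is negative, so the evolution is read at its absolute value
    and the bound uses the absolute value of [E]. *)
Theorem theorem3p1 (R : realType) (O : finType) (T : {set O}) (n : nat)
    (A : 'I_n -> {set O}) (alpha : 'I_n -> R) (nu E : R)
    (T_covered : T \subset (\bigcup_(j < n) A j)%SET)
    (alpha_gt0 : forall j : 'I_n, 0 < alpha j)
    (alpha_sum : \sum_(j < n) alpha j = 1)
    (nu_gt0 : 0 < nu)
    (s_unit : hnorm (initial_state A alpha nu) = 1)
    (E_neq0 : E != 0)
    (basic_confidence : forall j : 'I_n, (A j :&: T)%SET != finset.set0) :
  let s := initial_state A alpha nu in
  let l := #|T| in
  let r := #|((\bigcup_(j < n) A j) :\: T)%SET| in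
  let y := Num.sqrt (\sum_(w in T) beta A alpha nu w ^+ 2) in
  let time := pi / (2 * E * y) in
  1 / (Num.sqrt n%:R * Num.sqrt (l + r)%:R) <= y /\
  forall psi : R -> hilbert R O, schrodinger (hamiltonian T E s) s psi ->
    (0 < E ->
       psi time \in target_space R T /\
       time <= pi * Num.sqrt n%:R / (2 * E) * Num.sqrt (l + r)%:R) /\
    (E < 0 ->
       psi `|time| \in target_space R T /\
       `|time| <= pi * Num.sqrt n%:R / (2 * `|E|) * Num.sqrt (l + r)%:R).
Proof.
move=> s l r y time.
have sE := @initial_state_amplitude R O n A alpha nu.
have be1 : \sum_w beta A alpha nu w ^+ 2 = 1.
  apply: complexI; rewrite -sum_enum_val.
  transitivity (hnorm s ^+ 2); last by rewrite s_unit expr1n.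
  rewrite sqrtCK /braket mxE; apply: eq_bigr => k _.
  by rewrite (adjoint_amplitude sE) sE -rmorphM -expr2.
have lr : (l + r)%N = #|(\bigcup_(j < n) A j)%SET|.
  by rewrite -(cardsID T (\bigcup_(j < n) A j)%SET) (finset.setIidPr T_covered).
have n_gt0 : 0 < n%:R :> R.
  rewrite ltr0n lt0n; apply/eqP => n0; move: alpha_sum.
  by subst n; rewrite big_ord0 => /eqP; rewrite eq_sym oner_eq0.
have nu_lr : 1 <= nu^-1 ^+ 2 * (l + r)%:R.
  by rewrite -[leLHS]be1 lr; exact: sum_beta_sqr_le.
have lr_gt0 : 0 < (l + r)%:R :> R.
  rewrite ltr0n lt0n; apply/eqP => lr0; move: nu_lr.
  by rewrite lr0 mulr0 ler10.
have y_ge : 1 / (Num.sqrt n%:R * Num.sqrt (l + r)%:R) <= y.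
  rewrite -sqrtrM ?(ltW n_gt0) // div1r -sqrtrV ?mulr_ge0 ?(ltW n_gt0) ?(ltW lr_gt0) //.
  (* Under the root: [1 / (n (l + r)) <= nu^-2 / n <= y^2], the first step being [nu_lr]. *)
  apply: ler_wsqrtr; apply: le_trans (sum_beta_sqr_ge _ alpha_gt0 alpha_sum basic_confidence).
  rewrite invfM mulrC ler_pM2r ?invr_gt0 //.
  by rewrite -[_^-1]mul1r ler_pdivrMr.
have sqrts_gt0 : 0 < Num.sqrt n%:R * Num.sqrt (l + r)%:R :> R.
  by rewrite mulr_gt0 ?sqrtr_gt0.
have y_gt0 : 0 < y by apply: lt_le_trans y_ge; rewrite div1r invr_gt0.
have bey : \sum_(w in T) beta A alpha nu w ^+ 2 = y ^+ 2.
  by rewrite sqr_sqrtr // sumr_ge0 // => w _; exact: sqr_ge0.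
(* Stated for any positive [e], to be used with [E] and with its absolute value. *)
have time_le (e : R) : 0 < e ->
    pi / (2 * e * y) <= pi * Num.sqrt n%:R / (2 * e) * Num.sqrt (l + r)%:R.
  move=> e_gt0; rewrite invfM mulrA -!mulrA ler_pM2l ?pi_gt0 //.
  rewrite mulrCA ler_pM2l ?invr_gt0 ?mulr_gt0 //.
  by rewrite -[leRHS]invrK lef_pV2 ?posrE ?invr_gt0 // -div1r.
have reach psi (t : R) : schrodinger (hamiltonian T E s) s psi ->
    0 < t -> cos (E * y * t) = 0 -> psi t \in target_space R T.
  move=> psiE t_gt0 c0; apply: mem_target_space => w.
  exact: off_target_amplitude sE be1 bey y_gt0 psiE t_gt0 c0.
split=> // psi psiE; split=> [E_gt0|E_lt0].
  split; last exact: time_le.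
  apply: (reach _ _ psiE); first by rewrite divr_gt0 ?pi_gt0 // !mulr_gt0.
  rewrite (_ : E * y * time = pi / 2) ?cos_pihalf // /time.
  by field; rewrite !gt_eqF.
have -> : `|time| = pi / (2 * `|E| * y).
  by rewrite /time normf_div !normrM normr_nat (gtr0_norm (pi_gt0 R)) (gtr0_norm y_gt0).
have normE_gt0 : 0 < `|E| by rewrite normr_gt0.
split; last exact: time_le.
apply: (reach _ _ psiE); first by rewrite divr_gt0 ?pi_gt0 // !mulr_gt0.
(* For negative [E] the angle is [- pi / 2], where the cosine vanishes as well. *)
rewrite ltr0_norm // (_ : E * y * _ = - (pi / 2)) ?cosN ?cos_pihalf //.
by field; rewrite E_neq0 gt_eqF.
Qed.
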